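(* Let $G$ be a group, $M$ a connected $G$-set, $\Gamma$ a connecting graph structure for $M$, and $\mathcal U$ a relatively hyperbolic uniformity on $M$. Then there exists $\lambda\in(0,1)$ such that $\mathcal U$ is contained in the Floyd uniformity $\mathsf U_{\Gamma,\lambda}$. The inclusion $\mathcal U\subset \mathsf U_{\Gamma,\lambda}$ induces a uniformly continuous $G$-equivariant surjective map from the completion of $(M,\mathsf U_{\Gamma,\lambda})$ to the completion of $(M,\mathcal U)$.
   Context: Pairs and uniformities. $\mathsf S^2M$ is the set of unordered pairs (repetition allowed) of elements of $M$, and $\Delta^2M$ is the set of pairs $\{x,x\}$. For $\mathbf u\subset \mathsf S^2M$ with $\mathbf u\supset\Delta^2M$ and $n\ge 1$, $\mathbf u^n$ is the set of pairs $\{x,y\}$ for which there are $x=x_0,\dots,x_n=y$ with $\{x_{i-1},x_i\}\in\mathbf u$. A uniformity on $M$ is a filter $\mathcal U$ of subsets of $\mathsf S^2M$ containing $\Delta^2M$ such that for every $\mathbf u\in\mathcal U$ there is $\mathbf v\in\mathcal U$ with $\mathbf v^2\subset\mathbf u$. The completion $\overline M$ of $(M,\mathcal U)$ is the (Hausdorff) space of minimal Cauchy filters, with canonical map $\iota:M\to\overline M$; the $\mathcal U$-boundary is $\overline M\setminus\iota(M)$. Graphs are without loops and multiple edges; $\Gamma^0,\Gamma^1$ are the sets of vertices and edges; $\mathsf d$ is the graph metric on $\Gamma^0$. A $G$-set $M$ is connected if there is a connected graph $\Gamma$ with an action of $G$ by automorphisms, $\Gamma^0=M$ as a $G$-set,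 and $\Gamma^1/G$ finite; such a $\Gamma$ is called a connecting (graph) structure for $M$. A divider on a connected $G$-set $M$ is a set $\mathbf u\subset\mathsf S^2M$ containing $\Delta^2M$ for which there is a finite $F\subset G$ with $\bigl(\bigcap_{f\in F}f\mathbf u\bigr)^2\subset\mathbf u$. The filter on $\mathsf S^2M$ generated by $\{g\mathbf u:g\in G\}$ is a uniformity, the uniformity generated by $\mathbf u$. A divider $\mathbf u$ is perspective if for every pair $\beta$ of points of $M$ the set $\{g\in G: g\beta\notin\mathbf u\}$ is finite. A uniformity $\mathcal U$ on a connected $G$-set $M$ is relatively hyperbolic if it is generated by a perspective divider and the $\mathcal U$-boundary has at least two points. Floyd uniformity. For $v\in M=\Gamma^0$ and $\lambda\in(0,1)$, $\delta_{v,\lambda}$ is the path metric on $M$ obtained by giving each edge $e$ of $\Gamma$ length $\lambda^{\mathsf d(v,e)}$, where $\mathsf d(v,e)$ is the smaller of the distances from $v$ to the endpoints of $e$. The uniformity determined by $\delta_{v,\lambda}$ does not depend on $v$; it is denoted $\mathsf U_{\Gamma,\lambda}$ and is $G$-invariant. *)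

(* Defs.v *)
From HB Require Import structures.
From mathcomp Require Import all_boot all_order all_algebra.
From mathcomp Require Import boolp classical_sets functions cardinality filter.
From mathcomp Require Import reals.

Set Implicit Arguments.
Unset Strict Implicit.
Unset Printing Implicit Defensive.

Import Order.TTheory GRing.Theory Num.Theory.

Local Open Scope classical_set_scope.
Local Open Scope ring_scope.

(* An unordered pair, repetition allowed, is encoded by its support, a subset
   of [M] of the form {x, y}. *)
Definition S2 (M : Type) : Type := {p : set M | exists x y, p = [set x; y]}.

Definition upair (M : Type) (x y : M) : S2 M :=
  exist _ [set x; y] (ex_intro _ x (ex_intro _ y erefl)).

Lemma S2_inj (M : Type) (p q : S2 M) : sval p = sval q -> p = q.
Proof. by case: p q => [p hp] [q hq] /= E; exact: eq_exist. Qed.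

Lemma S2P (M : Type) (p : S2 M) : exists x y, p = upair x y.
Proof. by case: (svalP p) => x [y E]; exists x, y; exact: S2_inj. Qed.

Lemma upairC (M : Type) (x y : M) : upair x y = upair y x.
Proof. by apply: S2_inj; rewrite /= setUC. Qed.

Lemma upair_eq (M : Type) (x y a b : M) :
  upair x y = upair a b -> (x = a /\ y = b) \/ (x = b /\ y = a).
Proof.
move=> /(congr1 sval) /= E.
have Ex : [set a; b] x by rewrite -E; left.
have Ey : [set a; b] y by rewrite -E; right.
have Ea : [set x; y] a by rewrite E; left.
have Eb : [set x; y] b by rewrite E; right.
move: Ex Ey Ea Eb; rewrite /setU /=.
by case=> -> [] -> [] ea [] eb; subst; auto.
Qed.

Fact smap_subproof (M N : Type) (f : M -> N) (p : S2 M) :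
  exists x y, f @` sval p = [set x; y].
Proof.
case: (S2P p) => x [y ->]; exists (f x), (f y).
by rewrite /= image_setU !image_set1.
Qed.

Definition smap (M N : Type) (f : M -> N) (p : S2 M) : S2 N :=
  exist _ (f @` sval p) (smap_subproof f p).

Lemma smapE (M N : Type) (f : M -> N) x y :
  smap f (upair x y) = upair (f x) (f y).
Proof. by apply: S2_inj; rewrite /= image_setU !image_set1. Qed.

Definition sdiag (M : Type) : set (S2 M) := range (fun x : M => upair x x).

Definition spow (M : Type) (u : set (S2 M)) (n : nat) : set (S2 M) :=
  [set p | exists x : nat -> M, p = upair (x 0%N) (x n) /\
     forall i, (i < n)%N -> u (upair (x i) (x i.+1))].

Lemma spow2P (M : Type) (u : set (S2 M)) x z :
  spow u 2 (upair x z) <-> exists y, u (upair x y) /\ u (upair y z).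
Proof.
split=> [[c [E h]]|[y [h1 h2]]].
  have h1 := h 0%N isT; have h2 := h 1%N isT.
  case: (upair_eq E) => -[-> ->]; exists (c 1%N) => //.
  by rewrite upairC; split=> //; rewrite upairC.
exists (fun i => if i is i'.+1 then if i' is _.+1 then z else y else x).
by split=> // -[|[|//]].
Qed.

(* The filter is not required to be proper: it is so as soon as [M] is nonempty,
   since every member contains the diagonal. *)
Record uniformity (M : Type) := Uniformity {
  ents :> set (S2 M) -> Prop;
  ents_filter : Filter ents;
  ents_diag : forall u, ents u -> @sdiag M `<=` u;
  ents_half : forall u, ents u -> exists2 v, ents v & spow v 2 `<=` u
}.

Definition unif_continuous (M N : Type) (U : uniformity M) (V : uniformity N)
  (f : M -> N) : Prop := forall v, V v -> U (smap f @^-1` v).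

Definition small (M : Type) (u : set (S2 M)) (A : set M) : Prop :=
  forall x y, A x -> A y -> u (upair x y).

Definition cauchy_filter (M : Type) (U : uniformity M) (F : set_system M) :
  Prop := ProperFilter F /\ forall u, U u -> exists2 A, F A & small u A.

Definition minimal_cauchy (M : Type) (U : uniformity M) (F : set_system M) :
  Prop := cauchy_filter U F /\
          forall F', cauchy_filter U F' -> F' `<=` F -> F' = F.

Definition completion (M : Type) (U : uniformity M) : Type :=
  {F : set_system M | minimal_cauchy U F}.

(* The neighborhood filter of [x], which is the unique minimal Cauchy filter
   contained in the principal filter of [x]. *)
Definition unif_nbhs (M : Type) (U : uniformity M) (x : M) : set_system M :=
  filter_from (ents U) (fun u => [set y | u (upair x y)]).

Lemma unif_refl (M : Type) (U : uniformity M) u x : U u -> u (upair x x).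
Proof. by move=> Uu; apply: (ents_diag Uu); exists x. Qed.

Lemma unif_nbhs_minimal (M : Type) (U : uniformity M) x :
  minimal_cauchy U (unif_nbhs U x).
Proof.
have FU := ents_filter U.
split; first split.
- apply: filter_from_proper; last first.
    by move=> u Uu; exists x; exact: unif_refl Uu.
  apply: filter_from_filter; [by exists setT; exact: filterT|].
  by move=> u v Uu Uv; exists (u `&` v); [exact: filterI|move=> y []].
- move=> u /ents_half[v Uv vu]; exists [set y | v (upair x y)].
    by exists v.
  by move=> y z /= vy vz; apply/vu/spow2P; exists x; rewrite upairC.
- move=> F [PF CF] Fx; apply/seteqP; split=> // A [u Uu uA].
  have [B FB Bu] := CF _ Uu.
  have [v Uv vB] := Fx _ FB.
  apply: filterS FB => y By; apply/uA/Bu => //; apply/vB; exact: unif_refl Uv.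
Qed.

Definition to_completion (M : Type) (U : uniformity M) (x : M) : completion U :=
  exist _ (unif_nbhs U x) (unif_nbhs_minimal U x).

Definition boundary (M : Type) (U : uniformity M) : set (completion U) :=
  ~` range (@to_completion M U).

(* The uniformity of the completion is the usual one: a basic entourage
   consists, for an entourage [u] of [U], of the pairs of minimal Cauchy filters
   which have a [u]-small set in common. *)
Definition completion_basic (M : Type) (U : uniformity M) (u : set (S2 M)) :
  set (S2 (completion U)) :=
  [set p | exists xi eta, p = upair xi eta /\
     exists A, [/\ sval xi A, sval eta A & small u A]].

Lemma completion_basicP (M : Type) (U : uniformity M) u (xi eta : completion U) :
  completion_basic u (upair xi eta) <->
  exists A, [/\ sval xi A, sval eta A & small u A].
Proof.
split=> [[a [b [E [A [h1 h2 h3]]]]]|h]; last by exists xi, eta.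
by exists A; case: (upair_eq E) => -[-> ->].
Qed.

Definition completion_ents (M : Type) (U : uniformity M) :
  set_system (S2 (completion U)) :=
  filter_from (ents U) (@completion_basic M U).

Lemma completion_ents_filter (M : Type) (U : uniformity M) :
  Filter (@completion_ents M U).
Proof.
have FU := ents_filter U.
apply: filter_from_filter; [by exists setT; exact: filterT|].
move=> u v Uu Uv; exists (u `&` v); first exact: filterI.
move=> p; case: (S2P p) => a [b ->] /completion_basicP[A [h1 h2 h3]].
by split; apply/completion_basicP; exists A; split=> // x y Ax Ay;
  case: (h3 x y Ax Ay).
Qed.

Lemma completion_ents_diag (M : Type) (U : uniformity M) w :
  completion_ents w -> @sdiag (completion U) `<=` w.
Proof.
move=> [u Uu uw] _ [xi _ <-]; apply/uw/completion_basicP.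
case: (svalP xi) => -[_ /(_ u Uu)[A FA Au]] _.
by exists A.
Qed.

Lemma completion_ents_half (M : Type) (U : uniformity M) w :
  @completion_ents M U w ->
  exists2 v, completion_ents v & spow v 2 `<=` w.
Proof.
move=> [u /ents_half[v Uv vu] uw].
exists (@completion_basic M U v); first by exists v.
move=> p; case: (S2P p) => a [b ->].
move=> /spow2P[c [/completion_basicP[A [aA cA Av]]
                  /completion_basicP[B [cB bB Bv]]]].
apply/uw/completion_basicP.
have Pa : ProperFilter (sval a) := (svalP a).1.1.
have Pb : ProperFilter (sval b) := (svalP b).1.1.
have Pc : ProperFilter (sval c) := (svalP c).1.1.
have [z [Az Bz]] := filter_ex (filterI cA cB).
exists (A `|` B); split.
- by apply: filterS aA => t; left.
- by apply: filterS bB => t; right.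
- by move=> s t [As|Bs] [At|Bt]; apply/vu/spow2P; exists z; split; auto.
Qed.

Definition completion_uniformity (M : Type) (U : uniformity M) :
  uniformity (completion U) :=
  Uniformity (completion_ents_filter U) (@completion_ents_diag M U)
    (@completion_ents_half M U).

Record gset (G : groupType) := GSet {
  gset_sort :> Type;
  act : G -> gset_sort -> gset_sort;
  act1 : forall x, act 1%g x = x;
  actM : forall g h x, act (g * h)%g x = act g (act h x)
}.

Definition equivariant (G : groupType) (X Y : gset G) (f : X -> Y) : Prop :=
  forall g x, f (act g x) = act g (f x).

Definition sact (G : groupType) (M : gset G) (g : G) (p : S2 M) : S2 M :=
  smap (act g) p.

Lemma sactE (G : groupType) (M : gset G) (g : G) (x y : M) :
  sact g (upair x y) = upair (act g x) (act g y).
Proof. exact: smapE. Qed.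

Lemma actK (G : groupType) (M : gset G) (g : G) (x : M) :
  act g^-1%g (act g x) = x.
Proof. by rewrite -actM mulVg act1. Qed.

Lemma actVK (G : groupType) (M : gset G) (g : G) (x : M) :
  act g (act g^-1%g x) = x.
Proof. by rewrite -actM mulgV act1. Qed.

Lemma sact1 (G : groupType) (M : gset G) (p : S2 M) : sact 1%g p = p.
Proof. by case: (S2P p) => x [y ->]; rewrite sactE !act1. Qed.

Lemma sactM (G : groupType) (M : gset G) (g h : G) (p : S2 M) :
  sact (g * h)%g p = sact g (sact h p).
Proof. by case: (S2P p) => x [y ->]; rewrite !sactE !actM. Qed.

Lemma sact_image (G : groupType) (M : gset G) (g : G) (u : set (S2 M)) p :
  (sact g @` u) p <-> u (sact g^-1%g p).
Proof.
split=> [[q uq <-]|h]; first by rewrite -sactM mulVg sact1.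
by exists (sact g^-1%g p) => //; rewrite -sactM mulgV sact1.
Qed.

Definition unif_invariant (G : groupType) (M : gset G) (U : uniformity M) :
  Prop := forall g u, U u -> U (sact g @` u).

Lemma cauchy_act (G : groupType) (M : gset G) (U : uniformity M) g F :
  unif_invariant U -> cauchy_filter U F -> cauchy_filter U (act (g : G) @ F).
Proof.
move=> invU [PF CF]; split; first exact: fmap_proper_filter.
move=> u Uu; have [A FA Au] := CF _ (invU g^-1%g u Uu).
exists (act g @` A).
  by rewrite /fmap /=; apply: filterS FA => x Ax; exists x.
move=> _ _ [x Ax <-] [y Ay <-].
by have /sact_image := Au x y Ax Ay; rewrite invgK sactE.
Qed.

Lemma fmap_act1 (G : groupType) (M : gset G) (F : set_system M) :
  act (1%g : G) @ F = F.
Proof.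
apply/funext => A; rewrite /fmap /=; congr (F _).
by apply/funext => x; rewrite /preimage /= act1.
Qed.

Lemma fmap_actM (G : groupType) (M : gset G) g h (F : set_system M) :
  act ((g * h)%g : G) @ F = act g @ (act h @ F).
Proof.
apply/funext => A; rewrite /fmap /=; congr (F _).
by apply/funext => x; rewrite /preimage /= actM.
Qed.

Lemma minimal_cauchy_act (G : groupType) (M : gset G) (U : uniformity M) g F :
  unif_invariant U -> minimal_cauchy U F ->
  minimal_cauchy U (act (g : G) @ F).
Proof.
move=> invU [CF mF]; split; first exact: cauchy_act.
move=> F' CF' F'F.
rewrite -(mF (act g^-1%g @ F')); last first.
- move=> A /F'F; rewrite /fmap /=; congr (F _).
  by apply/funext => x; rewrite /preimage /= actK.
- exact: cauchy_act.
- by rewrite -fmap_actM mulgV fmap_act1.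
Qed.

(* A group element acts on a filter by taking the image filter. *)
Definition completion_act (G : groupType) (M : gset G) (U : uniformity M)
  (invU : unif_invariant U) (g : G) (xi : completion U) : completion U :=
  exist _ (act g @ sval xi) (minimal_cauchy_act g invU (svalP xi)).

Lemma completion_inj (M : Type) (U : uniformity M) (xi eta : completion U) :
  sval xi = sval eta -> xi = eta.
Proof. by case: xi eta => [p hp] [q hq] /= E; exact: eq_exist. Qed.

Fact completion_act1 (G : groupType) (M : gset G) (U : uniformity M)
  (invU : unif_invariant U) xi : completion_act invU 1%g xi = xi.
Proof. by apply: completion_inj; exact: fmap_act1. Qed.

Fact completion_actM (G : groupType) (M : gset G) (U : uniformity M)
  (invU : unif_invariant U) g h xi :
  completion_act invU (g * h)%g xi =
  completion_act invU g (completion_act invU h xi).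
Proof. by apply: completion_inj; exact: fmap_actM. Qed.

Definition completion_gset (G : groupType) (M : gset G) (U : uniformity M)
  (invU : unif_invariant U) : gset G :=
  GSet (completion_act1 invU) (completion_actM invU).

Definition is_walk (T : Type) (e : rel T) (x : T) (s : seq T) (y : T) : Prop :=
  path e x s /\ last x s = y.

(* A simple graph is given by its set of edges, a set of unordered pairs of
   distinct points of [M].  The last field says that the set of [G]-orbits of
   edges is finite. *)
Record connecting_graph (G : groupType) (M : gset G) := ConnectingGraph {
  edges : set (S2 M);
  edges_loopless : forall x, ~ edges (upair x x);
  edges_act : forall g p, edges (sact g p) <-> edges p;
  edges_connected : forall x y, exists s,
    is_walk (fun a b => `[< edges (upair a b) >]) x s y;
  edges_cofinite :
    finite_set [set range (fun g : G => sact g p) | p in edges]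
}.

Definition connected_gset (G : groupType) (M : gset G) : Prop :=
  inhabited (connecting_graph M).

Section graph_metric.
Context (G : groupType) (M : gset G) (Gamma : connecting_graph M).

Definition walk : M -> seq M -> M -> Prop :=
  is_walk (fun a b => `[< edges Gamma (upair a b) >]).

Fact gdist_subproof (x y : M) :
  exists n, `[< exists2 s, walk x s y & size s = n >].
Proof.
have [s hs] := edges_connected Gamma x y.
by exists (size s); apply/asboolP; exists s.
Qed.

Definition gdist (x y : M) : nat := ex_minn (gdist_subproof x y).

Lemma gdistP (x y : M) : exists2 s, walk x s y & size s = gdist x y.
Proof. by rewrite /gdist; case: ex_minnP => n /asboolP. Qed.

Lemma gdist_le (x y : M) s : walk x s y -> (gdist x y <= size s)%N.
Proof.
by move=> h; rewrite /gdist; case: ex_minnP => n _; apply; apply/asboolP; exists s.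
Qed.

Lemma walk_cat x y z s t : walk x s y -> walk y t z -> walk x (s ++ t) z.
Proof.
by move=> [p1 <-] [p2 <-]; split; rewrite ?cat_path ?p1 ?last_cat.
Qed.

Lemma gdist_triangle x y z : (gdist x z <= gdist x y + gdist y z)%N.
Proof.
have [s hs <-] := gdistP x y; have [t ht <-] := gdistP y z.
by rewrite -size_cat; apply: gdist_le; exact: walk_cat hs ht.
Qed.

Definition edge_dist (v a b : M) : nat := minn (gdist v a) (gdist v b).

End graph_metric.

Section floyd.
Context (R : realType) (G : groupType) (M : gset G) (Gamma : connecting_graph M).
Implicit Types (lam : R) (v x y : M).

(* The length of the walk [x :: s], where the edge {a, b} has length
   [lam ^+ d(v, {a, b})]. *)
Definition floyd_length v lam x (s : seq M) : R :=
  \sum_(l <- pairmap (fun a b => lam ^+ edge_dist Gamma v a b) x s) l.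

Definition floyd_dist v lam x y : R :=
  inf [set floyd_length v lam x s | s in [set s | walk Gamma x s y]].

(* The entourages of the metric [floyd_dist v lam] do not depend on the base
   point [v] (see [floyd_entsE]); quantifying over all [v] avoids choosing one
   and makes the invariance under [G] immediate. *)
Definition floyd_ents lam : set_system (S2 M) :=
  [set u | forall v, exists2 e : R, 0 < e &
     forall x y, floyd_dist v lam x y < e -> u (upair x y)].

Section theory.
Context (lam : R) (hlam : 0 < lam < 1).

Let lam_gt0 : 0 < lam. Proof. by case/andP: hlam. Qed.
Let lam_lt1 : lam < 1. Proof. by case/andP: hlam. Qed.

Lemma floyd_length_cons v x a s :
  floyd_length v lam x (a :: s) =
  lam ^+ edge_dist Gamma v x a + floyd_length v lam a s.
Proof. by rewrite /floyd_length /= big_cons. Qed.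

Lemma floyd_length_cat v x s t :
  floyd_length v lam x (s ++ t) =
  floyd_length v lam x s + floyd_length v lam (last x s) t.
Proof. by rewrite /floyd_length pairmap_cat big_cat. Qed.

Lemma floyd_length_ge0 v x s : 0 <= floyd_length v lam x s.
Proof.
elim: s x => [|a s IH] x; first by rewrite /floyd_length big_nil.
by rewrite floyd_length_cons addr_ge0 // exprn_ge0 // ltW.
Qed.

Lemma floyd_has_inf v x y :
  has_inf [set floyd_length v lam x s | s in [set s | walk Gamma x s y]].
Proof.
split; last by exists 0 => _ [s _ <-]; exact: floyd_length_ge0.
have [s hs] := edges_connected Gamma x y.
by exists (floyd_length v lam x s); exists s.
Qed.

Lemma floyd_dist_le v x y s :
  walk Gamma x s y -> floyd_dist v lam x y <= floyd_length v lam x s.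
Proof.
by move=> h; apply: ge_inf; [exact: (floyd_has_inf v x y).2|exists s].
Qed.

Lemma floyd_dist_lt v x y e : floyd_dist v lam x y < e ->
  exists2 s, walk Gamma x s y & floyd_length v lam x s < e.
Proof.
move=> /(inf_lt (floyd_has_inf v x y).1)[_ [s hs <-] lt_e].
by exists s.
Qed.

Lemma floyd_distxx v x : floyd_dist v lam x x <= 0.
Proof.
have h : walk Gamma x [::] x by [].
by have := floyd_dist_le v h; rewrite /floyd_length /= big_nil.
Qed.

Lemma floyd_dist_triangle v x y z e f :
  floyd_dist v lam x y < e -> floyd_dist v lam y z < f ->
  floyd_dist v lam x z < e + f.
Proof.
move=> /floyd_dist_lt[s hs lt_e] /floyd_dist_lt[t ht lt_f].
apply: le_lt_trans (floyd_dist_le v (walk_cat hs ht)) _.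
by rewrite floyd_length_cat hs.2 ltrD.
Qed.

Lemma walk_rev v x s y : walk Gamma x s y -> exists2 t, walk Gamma y t x &
  floyd_length v lam y t = floyd_length v lam x s.
Proof.
elim: s x => [|a s IH] x.
  by move=> [_ /= <-]; exists [::].
move=> [/= /andP[xa p] l].
have [t ht E] := IH a (conj p l).
exists (t ++ [:: x]).
  apply: (walk_cat ht); split=> //=; rewrite andbT.
  by rewrite upairC.
rewrite floyd_length_cat !floyd_length_cons ht.2 E [RHS]addrC.
by rewrite /edge_dist minnC /floyd_length [in X in _ + (_ + X)]big_nil addr0.
Qed.

Lemma floyd_dist_sym v x y e :
  floyd_dist v lam x y < e -> floyd_dist v lam y x < e.
Proof.
move=> /floyd_dist_lt[s /(walk_rev v)[t ht <-]].
exact: le_lt_trans (floyd_dist_le v ht).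
Qed.

Lemma floyd_length_change v w x s :
  lam ^+ gdist Gamma w v * floyd_length v lam x s <= floyd_length w lam x s.
Proof.
elim: s x => [|a s IH] x; first by rewrite /floyd_length !big_nil mulr0.
rewrite !floyd_length_cons mulrDr lerD // -exprD.
apply: ler_wiXn2l; rewrite ?ltW //.
rewrite /edge_dist addn_minr leq_min.
by rewrite !(leq_trans _ (gdist_triangle _ _ _ _)) // (geq_minl, geq_minr).
Qed.

Lemma floyd_dist_change v w x y e : floyd_dist w lam x y < lam ^+ gdist Gamma w v * e ->
  floyd_dist v lam x y < e.
Proof.
move=> /floyd_dist_lt[s hs lt_e].
apply: le_lt_trans (floyd_dist_le v hs) _.
have P : 0 < lam ^+ gdist Gamma w v by exact: exprn_gt0.
rewrite -(ltr_pM2l P); exact: le_lt_trans (floyd_length_change v w x s) lt_e.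
Qed.

Lemma floyd_entsE w u : floyd_ents lam u <->
  exists2 e : R, 0 < e & forall x y, floyd_dist w lam x y < e -> u (upair x y).
Proof.
split=> [/(_ w)//|[e e0 h] v].
exists (lam ^+ gdist Gamma v w * e); first by rewrite mulr_gt0 // exprn_gt0.
by move=> x y /floyd_dist_change; exact: h.
Qed.

Lemma floyd_filter : Filter (floyd_ents lam).
Proof.
split=> [v|u u' hu hu' v|u u' uu' hu v].
- by exists 1.
- have [e e0 h] := hu v; have [e' e'0 h'] := hu' v.
  exists (Num.min e e'); first by rewrite lt_min e0.
  by move=> x y; rewrite lt_min => /andP[/h ? /h' ?].
- by have [e e0 h] := hu v; exists e => // x y /h /uu'.
Qed.

Lemma floyd_diag u : floyd_ents lam u -> @sdiag M `<=` u.
Proof.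
move=> hu _ [x _ <-]; have [e e0] := hu x.
by apply; exact: le_lt_trans (floyd_distxx x x) e0.
Qed.

Lemma floyd_half u :
  floyd_ents lam u -> exists2 v, floyd_ents lam v & spow v 2 `<=` u.
Proof.
move=> hu; have [[w]|noM] := pselect (inhabited M); last first.
  exists setT; first by move=> v; case: noM; split.
  by move=> p [x _]; case: noM; split; exact: (x 0%N).
have [e e0 h] := hu w.
exists [set p | exists x y, p = upair x y /\ floyd_dist w lam x y < e / 2].
  apply/(floyd_entsE w); exists (e / 2); first by rewrite divr_gt0.
  by move=> x y hxy; exists x, y.
have sym x y : [set p | exists a b, p = upair a b /\
    floyd_dist w lam a b < e / 2] (upair x y) -> floyd_dist w lam x y < e / 2.
  move=> [a [b [E lt_e]]].
  by case: (upair_eq E) => -[-> ->] //; exact: floyd_dist_sym.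
move=> p; case: (S2P p) => x [z ->] /spow2P[y [/sym h1 /sym h2]].
by apply: h; rewrite [e](splitr e); exact: floyd_dist_triangle h1 h2.
Qed.

Definition floyd_uniformity : uniformity M :=
  Uniformity floyd_filter floyd_diag floyd_half.

Lemma walk_act g x s y :
  walk Gamma x s y -> walk Gamma (act (g : G) x) (map (act g) s) (act g y).
Proof.
move=> [p l]; split; last by rewrite last_map l.
rewrite path_map; apply: sub_path p => a b /= /asboolP h.
by apply/asboolP; rewrite -sactE; apply/edges_act.
Qed.

Lemma gdist_act_le g v x :
  (gdist Gamma (act (g : G) v) (act g x) <= gdist Gamma v x)%N.
Proof.
have [s hs <-] := gdistP Gamma v x.
by rewrite -(size_map (act g)); apply: gdist_le; exact: walk_act.
Qed.

Lemma gdist_act g v x :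
  gdist Gamma (act (g : G) v) (act g x) = gdist Gamma v x.
Proof.
apply/eqP; rewrite eqn_leq gdist_act_le /=.
by have := gdist_act_le g^-1%g (act g v) (act g x); rewrite !actK.
Qed.

Lemma floyd_length_act g v x s :
  floyd_length (act (g : G) v) lam (act g x) (map (act g) s) =
  floyd_length v lam x s.
Proof.
elim: s x => [|a s IH] x; first by rewrite /floyd_length !big_nil.
by rewrite /= !floyd_length_cons IH /edge_dist !gdist_act.
Qed.

Lemma floyd_dist_act g v x y e : floyd_dist v lam x y < e ->
  floyd_dist (act (g : G) v) lam (act g x) (act g y) < e.
Proof.
move=> /floyd_dist_lt[s hs]; rewrite -(floyd_length_act g).
exact/le_lt_trans/floyd_dist_le/walk_act.
Qed.

Lemma floyd_invariant : unif_invariant floyd_uniformity.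
Proof.
move=> g u hu v; have [e e0 h] := hu (act g^-1%g v).
exists e => // x y lt_e; apply/sact_image; rewrite sactE.
by apply: h; exact: floyd_dist_act.
Qed.

End theory.
End floyd.

Section relatively_hyperbolic.
Context (G : groupType) (M : gset G).

Definition divider (u : set (S2 M)) : Prop :=
  @sdiag M `<=` u /\
  exists2 F : set G, finite_set F &
    spow (\bigcap_(f in F) (sact f @` u)) 2 `<=` u.

Definition perspective (u : set (S2 M)) : Prop :=
  forall b : S2 M, finite_set [set g : G | ~ u (sact g b)].

Definition generated_by (U : uniformity M) (u : set (S2 M)) : Prop :=
  ents U = smallest Filter (range (fun g : G => sact g @` u)).

Definition relatively_hyperbolic (U : uniformity M) : Prop :=
  (exists u, [/\ divider u, perspective u & generated_by U u]) /\
  (exists xi eta, [/\ @boundary M U xi, @boundary M U eta & xi <> eta]).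

Lemma generated_invariant U u : generated_by U u -> unif_invariant U.
Proof.
move=> E g w; rewrite E => hw.
apply: (@smallest_sub _ _ _ [set w | smallest Filter
  (range (fun g : G => sact g @` u)) (sact g @` w)] _ _ _ hw).
  set S := smallest _ _; have FS : Filter S by exact: smallest_filter_filter.
  split=> /=.
  - by apply: (filterS _ (@filterT _ S FS)) => p _; apply/sact_image.
  - move=> a b Sa Sb; apply: (filterS _ (@filterI _ S FS _ _ Sa Sb)) => p.
    by move=> [/sact_image ? /sact_image ?]; exact/sact_image.
  - move=> a b ab; apply: (@filterS _ S FS) => p /sact_image/ab ?.
    exact/sact_image.
move=> _ [h _ <-] /=; apply: sub_gen_smallest; exists (g * h)%g => //.
apply/seteqP; split=> p.
  move=> [q uq <-]; exists (sact h q); first by exists q.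
  by rewrite sactM.
by move=> [_ [q uq <-] <-]; exists q => //; rewrite sactM.
Qed.

Lemma relatively_hyperbolic_invariant U :
  relatively_hyperbolic U -> unif_invariant U.
Proof. by move=> [[u [_ _ /generated_invariant]]]. Qed.

End relatively_hyperbolic.

Arguments floyd_invariant {R G M} Gamma {lam} hlam.
Arguments relatively_hyperbolic_invariant {G M U}.

(* Main.v *)
Require Import Defs.
From mathcomp Require Import all_boot all_order all_algebra.
From mathcomp Require Import boolp classical_sets functions cardinality filter.
From mathcomp Require Import reals.
From mathcomp Require Import zify ring lra.

Import Order.TTheory GRing.Theory Num.Theory.
Local Open Scope classical_set_scope.
Local Open Scope ring_scope.

Set Implicit Arguments.
Unset Strict Implicit.
Unset Printing Implicit Defensive.

(** Why the theorem holds.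

    Let [u] be a perspective divider generating [U], and let [F] be a finite set
    of group elements with (the intersection of the [f u], [f] in [F]) squared
    contained in [u].  Put [w_0 = u] and let [w_(n+1)] be the intersection of
    [w_n] with its translates by [F].  Then [w_(n+1)] squared lies in [w_n].
    Perspectivity and the finiteness of the set of edge orbits show that all but
    finitely many edges belong to [u]; and since [F] moves a base point [v] by a
    bounded amount, an edge belongs to [w_n] as soon as its distance from [v]
    exceeds an affine function [C n + D] ([far_edges_divider_iter]).  If [lam] is
    so close to 1 that [lam ^ (2 C) >= 1/2], an edge of Floyd length less than
    [lam ^ D / 2 ^ n] is therefore in [w_(2n)].  The chain argument of the
    metrization lemma for uniform spaces ([chain_metrization]) passes from edges
    to paths: points at small Floyd distance form a pair in [u]
    ([divider_in_floyd]).  The Floyd uniformity being invariant, it contains the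
    whole of [U].

    An inclusion [U <= V] of uniformities makes every [V]-Cauchy filter
    [U]-Cauchy, and every Cauchy filter contains exactly one minimal one, its
    core; taking cores is the induced map of completions.  Equivariance and the
    value at the points of [M] follow from uniqueness; uniform continuity holds
    because a small set common to two filters has an enlargement common to their
    cores, which is still small.

    Surjectivity is the delicate point, because [Gamma] need not be locally
    finite and the Floyd completion need not be compact.  Let [W] be an
    ultrafilter finer than a given minimal [U]-Cauchy filter, and choose for each
    [x] a geodesic [c x] from [v] to [x].  The tail of [c x] beyond its [j]-th
    vertex has Floyd length at most [lam ^ j / (1 - lam)].  If for arbitrarily
    large [j] the vertex [c x j] is the same for [W]-almost all [x], then [W] is
    Floyd-Cauchy.  Otherwise there is a last such level [K], with common vertex
    [a].  At each level beyond it, almost every [c x] avoids any prescribed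
    finite set of vertices; as every entourage of [U] contains all but finitely
    many edges, the next [J] steps of [c x] after [a] are, for any given [J], as
    [U]-short as desired, and the remaining tail is Floyd-short for [J] large.
    So [W] converges to [a] in [U] ([ultrafilter_dichotomy]).  In both cases the
    given point of the completion is in the image. *)

(** * Finite sets and integers *)

Lemma finite_set_bounded (T : Type) (A : set T) (f : T -> nat) :
  finite_set A -> exists N, forall a, A a -> (f a <= N)%N.
Proof.
move=> /(finite_image f)/finite_seqP[s E]; exists (\max_(n <- s) n).
move=> a Aa; have : (f @` A) (f a) by exists a.
by rewrite E /= => fs; exact: leq_bigmax_seq.
Qed.

Lemma filter_finite_bigI (T I : Type) (F : set_system T) (A : set I)
    (P : I -> set T) : Filter F -> finite_set A ->
  (forall i, A i -> F (P i)) -> F (\bigcap_(i in A) P i).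
Proof.
move=> FF.
(* [finite_seqP] wants decidable equality, which the alias [{classic I}] has. *)
move=> /(@finite_seqP {classic I})[s ->] /=.
elim: s => [|i s IH] FP.
  by apply: filterS (@filterT _ F FF) => x _ i.
have Fi := FP i (mem_head _ _).
have Fs : F (\bigcap_(j in [set` s]) P j).
  by apply: IH => j js; apply: FP; rewrite /= in_cons js orbT.
apply: filterS (filterI Fi Fs) => x [Pi Ps] j /=.
by rewrite in_cons => /orP[/eqP ->|/Ps].
Qed.

Lemma last_index (P : nat -> Prop) : P 0%N ->
  (forall J, exists2 j, (J <= j)%N & P j) \/
  (exists2 K, P K & forall j, (K < j)%N -> ~ P j).
Proof.
move=> P0; have [?|nf] := pselect (forall J, exists2 j, (J <= j)%N & P j).
  by left.
right; have [J hJ] : exists J, forall j, P j -> (j <= J)%N.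
  apply: contrapT => nJ; apply: nf => J; apply: contrapT => nj; apply: nJ.
  exists J => j Pj; rewrite leqNgt; apply/negP => lt_Jj; apply: nj.
  by exists j => //; exact: ltnW.
have exP : exists j, `[< P j >] by exists 0%N; apply/asboolP.
case: (ex_maxnP (m := J) exP) => [j /asboolP|K /asboolP PK maxK].
  exact: hJ.
exists K => // j lt_Kj Pj; have := maxK j (asboolT Pj); lia.
Qed.

(** * Powers of a ratio less than 1 *)

Lemma bernoulli_le (R : realType) (t : R) n :
  0 <= t <= 1 -> 1 - n%:R * t <= (1 - t) ^+ n.
Proof.
move=> /andP[t0 t1]; elim: n => [|n IH]; first by rewrite expr0; lra.
rewrite exprS; apply: (@le_trans _ _ ((1 - t) * (1 - n%:R * t))).
  rewrite -[n.+1]addn1 natrD.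
  have : 0 <= n%:R * t * t by rewrite !mulr_ge0.
  nra.
by rewrite ler_wpM2l // subr_ge0.
Qed.

(** The ratio [1 - 1 / (2 (N + 1))] works, by Bernoulli's inequality; [N + 1]
    rather than [N] makes it less than 1 also when [N = 0]. *)
Lemma slow_ratio (R : realType) (N : nat) :
  exists2 lam : R, 0 < lam < 1 & 2^-1 <= lam ^+ N.
Proof.
have h := bernoulli_le N (t := (2 * N.+1%:R)^-1 : R).
have t0 : 0 < (2 * N.+1%:R)^-1 :> R by rewrite invr_gt0 mulr_gt0.
have t1 : (2 * N.+1%:R)^-1 <= 2^-1 :> R.
  by rewrite lef_pV2 ?posrE ?mulr_gt0 // ler_peMr // ler1n.
set t := (_)^-1 in t0 t1 h *.
exists (1 - t); first by apply/andP; lra.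
apply: le_trans (h _); last by apply/andP; lra.
have : N%:R * t <= 2^-1 :> R.
  rewrite /t invfM mulrCA; apply: ler_piMr; first by rewrite invr_ge0.
  by rewrite ler_pdivrMr // mul1r ler_nat.
lra.
Qed.

Lemma geometric_small (R : realType) (lam e : R) : 0 < lam < 1 -> 0 < e ->
  exists J, forall j, (J <= j)%N -> lam ^+ j / (1 - lam) < e.
Proof.
move=> hlam e0; have [lam0 lam1] := andP hlam.
set mu := 1 - lam; have mu0 : 0 < mu by rewrite subr_gt0.
(* A quantitative form of the decay: [lam ^ j] is at most [1 / (1 + j mu)]. *)
have decay j : lam ^+ j * (1 + j%:R * mu) <= 1.
  elim: j => [|j IH]; first by rewrite mul0r addr0 mulr1.
  apply: le_trans IH; rewrite exprSr -mulrA ler_wpM2l ?exprn_ge0 ?ltW //.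
  have j0 : 0 <= j%:R * (mu * mu) by rewrite !mulr_ge0 // ltW.
  have m0 : 0 <= mu * mu by rewrite mulr_ge0 // ltW.
  have -> : lam = 1 - mu by rewrite /mu; ring.
  by rewrite -[j.+1]addn1 natrD; nra.
exists (Num.bound (e * mu * mu)^-1) => j le_j.
have emm : 0 < e * mu * mu by rewrite !mulr_gt0.
have big : (e * mu * mu)^-1 < j%:R.
  apply: lt_le_trans (archi_boundP _) _; first by rewrite invr_ge0 ltW.
  by rewrite ler_nat.
have jmu : 0 < 1 + j%:R * mu by rewrite ltr_wpDr // mulr_ge0 // ltW.
rewrite ltr_pdivrMr // -(ltr_pM2r jmu); apply: (le_lt_trans (decay j)).
rewrite -(ltr_pM2l emm) divff ?gt_eqF // in big.
have : 0 < e * mu by rewrite mulr_gt0.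
by nra.
Qed.

(** * Minimal Cauchy filters *)

Section uniformity.
Context (M : Type) (U : uniformity M).

Lemma spow_small_chain (u v : set (S2 M)) x y z :
  spow v 2 `<=` u -> v (upair x y) -> v (upair y z) -> u (upair x z).
Proof. by move=> vu xy yz; apply/vu/spow2P; exists y. Qed.

(** The factor two in the halving axiom of uniformities can be replaced by any
    [n].  Chains are functions on [nat], of which only the first [n] steps
    matter. *)
Lemma entourage_chain u n : U u -> exists2 w, U w &
  forall c : nat -> M, (forall i, (i < n)%N -> w (upair (c i) (c i.+1))) ->
    u (upair (c 0%N) (c n)).
Proof.
have FU := ents_filter U.
elim: n u => [|n IH] u Uu; first by exists u => // c _; exact: unif_refl Uu.
have [v Uv vu] := ents_half Uu; have [w Uw wv] := IH v Uv.
exists (v `&` w); first exact: filterI.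
move=> c hc; apply: (spow_small_chain vu) (proj1 (hc n _)) => //.
by apply: wv => i lt_in; apply: (proj2 (hc i _)); exact: ltnW.
Qed.

Definition enlarge (u : set (S2 M)) (A : set M) : set M :=
  [set y | exists2 x, A x & u (upair x y)].

(** The traditional construction of the minimal Cauchy filter contained in a
    Cauchy filter. *)
Definition cauchy_core (F : set_system M) : set_system M :=
  [set B | exists u A, [/\ U u, F A & enlarge u A `<=` B]].

Lemma small_enlarge u : U u -> exists2 v, U v &
  forall A, small v A -> small u (enlarge v A).
Proof.
move=> /entourage_chain-/(_ 3%N)[v Uv vu]; exists v => // A sA x y.
move=> [a Aa ax] [b Ab bY].
apply: (vu (fun i => nth y [:: x; a; b] i)) => -[|[|[|//]]] _ //=.
  by rewrite upairC.
exact: sA.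
Qed.

Lemma cauchy_core_sub F : Filter F -> cauchy_core F `<=` F.
Proof.
move=> FF B [u [A [Uu FA AB]]]; apply: filterS FA => x Ax; apply: AB.
by exists x => //; exact: unif_refl Uu.
Qed.

(** A small member of [F'] is a member of [F] too, so it meets every [A] in [F];
    being small, it is then contained in the enlargement of [A]. *)
Lemma cauchy_core_least F F' :
  ProperFilter F -> cauchy_filter U F' -> F' `<=` F -> cauchy_core F `<=` F'.
Proof.
move=> PF [PF' CF'] F'F B [u [A [Uu FA AB]]].
have [A' FA' sA'] := CF' u Uu.
have [z [Az A'z]] := filter_ex (filterI FA (F'F _ FA')).
by apply: filterS FA' => y A'y; apply: AB; exists z => //; exact: sA'.
Qed.

Lemma cauchy_core_minimal F :
  cauchy_filter U F -> minimal_cauchy U (cauchy_core F).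
Proof.
have FU := ents_filter U.
move=> [PF CF]; have sub := @cauchy_core_sub F _.
split; last first.
  move=> F' CF' F'c; apply/seteqP; split=> //.
  by apply: cauchy_core_least => // A /F'c/sub.
split; first split.
- move=> /sub; exact: filter_not_empty.
- split.
  + by exists setT, setT; split=> //; exact: filterT.
  + move=> B B' [u [A [Uu FA AB]]] [u' [A' [Uu' FA' AB']]].
    exists (u `&` u'), (A `&` A'); split; [exact: filterI|exact: filterI|].
    move=> y [x [Ax A'x] [ux u'x]].
    by split; [apply: AB|apply: AB']; exists x.
  + move=> B B' BB' [u [A [Uu FA AB]]]; exists u, A; split=> //.
    exact: subset_trans BB'.
- move=> u /small_enlarge[v Uv vu]; have [A FA vA] := CF v Uv.
  exists (enlarge v A); last exact: vu.
  by exists v, A; split.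
Qed.

Lemma cauchy_filter_finer F F' :
  ProperFilter F -> cauchy_filter U F' -> F' `<=` F -> cauchy_filter U F.
Proof.
by move=> PF [_ CF'] F'F; split=> // u /CF'[A /F'F FA sA]; exists A.
Qed.

(** Two minimal Cauchy filters with a common refinement [F] coincide: this is
    how all equalities between points of a completion are proved below. *)
Lemma minimal_cauchy_core F F' : ProperFilter F -> minimal_cauchy U F' ->
  F' `<=` F -> F' = cauchy_core F.
Proof.
move=> PF [CF' mF'] F'F; apply/esym/mF'; last exact: cauchy_core_least.
exact: (cauchy_core_minimal (cauchy_filter_finer PF CF' F'F)).1.
Qed.

End uniformity.

(** * The map of completions induced by an inclusion of uniformities *)

Section induced_map.
Context (M : Type) (U V : uniformity M) (UV : ents U `<=` ents V).

Lemma cauchy_filter_coarser F : cauchy_filter V F -> cauchy_filter U F.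
Proof. by move=> [PF CF]; split=> // u /UV; exact: CF. Qed.

Definition completion_map (xi : completion V) : completion U :=
  exist _ _ (cauchy_core_minimal (cauchy_filter_coarser (svalP xi).1)).

(** The map need not be computed: a point of the coarser completion is the image
    of [xi] as soon as it has a common refinement with [xi]. *)
Lemma completion_map_eq (xi : completion V) (eta : completion U)
    (F : set_system M) : ProperFilter F ->
  sval xi `<=` F -> sval eta `<=` F -> completion_map xi = eta.
Proof.
move=> PF xiF etaF; apply: completion_inj.
have Pxi : ProperFilter (sval xi) := (svalP xi).1.1.
rewrite (minimal_cauchy_core PF (svalP eta) etaF).
apply: (minimal_cauchy_core PF (svalP (completion_map xi))).
exact: subset_trans (@cauchy_core_sub _ U (sval xi) _) xiF.
Qed.

Lemma completion_map_point x :
  completion_map (to_completion V x) = to_completion U x.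
Proof.
apply: (@completion_map_eq _ _ (unif_nbhs V x)) => //.
  exact: (unif_nbhs_minimal V x).1.1.
by move=> A [u /UV Vu uA]; exists u.
Qed.

Lemma completion_map_unif_continuous :
  unif_continuous (completion_uniformity V) (completion_uniformity U)
    completion_map.
Proof.
move=> w [u Uu uw]; have [v Uv vu] := small_enlarge Uu.
exists v; first exact: UV.
move=> p; case: (S2P p) => xi [eta ->] /completion_basicP[A [xA eA vA]] /=.
rewrite /preimage /= smapE; apply/uw/completion_basicP.
by exists (enlarge v A); split; [exists v, A; split|exists v, A; split|exact: vu].
Qed.

End induced_map.

Lemma completion_map_equivariant (G : groupType) (M : gset G)
    (U V : uniformity M) (UV : ents U `<=` ents V)
    (invU : unif_invariant U) (invV : unif_invariant V) :
  @equivariant G (completion_gset invV) (completion_gset invU)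
    (completion_map UV).
Proof.
move=> g xi; have Pxi : ProperFilter (sval xi) := (svalP xi).1.1.
apply: (@completion_map_eq _ _ _ _ _ _ (act g @ sval xi)) => //=.
by move=> A; apply: cauchy_core_sub.
Qed.

(** * Edges outside an entourage *)

Section edges.
Context (G : groupType) (M : gset G) (Gamma : connecting_graph M).

Definition edge_cofinite (w : set (S2 M)) : Prop :=
  finite_set [set p | edges Gamma p /\ ~ w p].

(** On the orbit of an edge [q], the edges [h q] outside [g u] correspond to
    the elements [k = g^-1 h] that move [q] out of [u], which are finitely many
    by perspectivity; and there are finitely many orbits of edges. *)
Lemma perspective_translate_edge_cofinite u g :
  perspective u -> edge_cofinite (sact g @` u).
Proof.
move=> pu.
apply: sub_finite_set (bigcup_finite
  (F := fun O => O `&` [set p | ~ (sact g @` u) p])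
  (edges_cofinite Gamma) _) => [p [ep np]|_ [q _ <-]].
  exists (range (fun h : G => sact h p)); first by exists p.
  by split=> //; exists 1%g => //; exact: sact1.
apply: sub_finite_set (finite_image (fun k => sact (g * k)%g q) (pu q)).
move=> _ [[h _ <-] nu]; exists (g^-1 * h)%g; last by rewrite mulgA mulgV mul1g.
by rewrite /= sactM => uq; apply/nu/sact_image.
Qed.

Lemma entourage_edge_cofinite (U : uniformity M) u w :
  perspective u -> generated_by U u -> U w -> edge_cofinite w.
Proof.
move=> pu EU; rewrite EU => Uw.
apply: (@smallest_sub _ _ _ edge_cofinite _ _ _ Uw); last first.
  by move=> _ [g _ <-]; exact: perspective_translate_edge_cofinite.
split.
- by apply: sub_finite_set (@finite_set0 _) => p [_ np]; case: np.
- move=> a b fa fb; have fab := conj fa fb; rewrite -finite_setU in fab.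
  apply: sub_finite_set fab => p [ep nab].
  have [ap|nap] := pselect (a p); last by left.
  by right; split=> // bp; apply: nab.
- by move=> a b ab; apply: sub_finite_set => p [ep nb]; split=> // /ab.
Qed.

End edges.

(** * The sequence of entourages attached to a divider *)

Section divider_chain.
Context (G : groupType) (M : gset G) (Gamma : connecting_graph M).
Context (u : set (S2 M)) (F : set G).

(** Intersecting with [divider_iter n'] itself amounts to adding the identity to
    [F]; it makes the sequence decreasing. *)
Fixpoint divider_iter (n : nat) : set (S2 M) :=
  if n is n'.+1 then
    divider_iter n' `&` \bigcap_(f in F) (sact f @` divider_iter n')
  else u.

Lemma divider_iter_diag n : @sdiag M `<=` u -> @sdiag M `<=` divider_iter n.
Proof.
move=> du; elim: n => [//|n IH] p dp; split; first exact: IH.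
move=> f _; apply/sact_image/IH.
by case: dp => x _ <-; exists (act f^-1%g x) => //; rewrite sactE.
Qed.

(** The step from [n] to [n + 1] is the divider property of [u] translated by
    products of [n] elements of [F]: each translate of a chain is a chain. *)
Lemma divider_iter_half n :
  spow (\bigcap_(f in F) (sact f @` u)) 2 `<=` u ->
  spow (divider_iter n.+1) 2 `<=` divider_iter n.
Proof.
move=> hu; elim: n => [|n IH] p; case: (S2P p) => x [z ->].
  by move=> /spow2P[y [[_ xy] [_ yz]]]; apply/hu/spow2P; exists y.
move=> /spow2P[y [[xy xyF] [yz yzF]]]; split.
  by apply/IH/spow2P; exists y.
move=> f Ff; apply/sact_image; rewrite sactE; apply/IH/spow2P.
exists (act f^-1%g y); rewrite -!sactE.
by split; apply/sact_image; [exact: xyF|exact: yzF].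
Qed.

Lemma edge_dist_act g v x y :
  edge_dist Gamma (act (g : G) v) (act g x) (act g y) = edge_dist Gamma v x y.
Proof. by rewrite /edge_dist !gdist_act. Qed.

Lemma edge_dist_change v w x y :
  (edge_dist Gamma v x y <= gdist Gamma v w + edge_dist Gamma w x y)%N.
Proof.
rewrite /edge_dist addn_minr leq_min.
by rewrite !(leq_trans _ (gdist_triangle _ _ _ _)) // (geq_minl, geq_minr).
Qed.

(** For [n = 0] only finitely many edges are excluded, so their distances from
    [v] have a bound [D].  An element [f] of [F] displaces [v] by at most [C], so
    that translating an edge by [f^-1] costs at most [C] of its distance from
    [v], and each increment of [n] is paid for by [C]. *)
Lemma far_edges_divider_iter v : finite_set F -> edge_cofinite Gamma u ->
  exists C D, forall n x y, edges Gamma (upair x y) ->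
    (C * n + D < edge_dist Gamma v x y)%N -> divider_iter n (upair x y).
Proof.
move=> finF cofu.
have [C hC] := finite_set_bounded (fun f => gdist Gamma v (act f v)) finF.
(* The distance to [v] as a function of the edge as an unordered pair. *)
have [ed edE] : exists ed : S2 M -> nat,
    forall x y, ed (upair x y) = edge_dist Gamma v x y.
  have /choice[ed edP] (p : S2 M) : exists n, exists x y,
      p = upair x y /\ n = edge_dist Gamma v x y.
    by have [x [y ->]] := S2P p; exists (edge_dist Gamma v x y), x, y.
  exists ed => x y; have [a [b [E ->]]] := edP (upair x y).
  by case: (upair_eq E) => -[-> ->]; rewrite // /edge_dist minnC.
have [D hD] := finite_set_bounded ed cofu.
exists C, D; elim=> [|n IH] x y exy far.
  apply: contrapT => nu; have := hD _ (conj exy nu).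
  by rewrite edE; lia.
split; first by apply: IH => //; lia.
move=> f Ff; apply/sact_image; rewrite sactE; apply: IH.
  by rewrite -sactE; apply/edges_act.
rewrite -(edge_dist_act f) !actVK.
have := edge_dist_change v (act f v) x y; have := hC f Ff.
by rewrite mulnS in far; lia.
Qed.

End divider_chain.

(** * Comparison with the Floyd metric *)

Section floyd_comparison.
Context (R : realType) (G : groupType) (M : gset G).
Context (Gamma : connecting_graph M) (lam : R) (hlam : 0 < lam < 1) (v : M).

Local Notation len := (floyd_length Gamma v lam).

Lemma walk_cons x a s y : walk Gamma x (a :: s) y <->
  edges Gamma (upair x a) /\ walk Gamma a s y.
Proof.
split=> [[/= /andP[/asboolP xa p] l]//|[xa [p l]]].
by split=> //=; apply/andP; split=> //; apply/asboolP.
Qed.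

Lemma walk_catP x s t z : walk Gamma x (s ++ t) z <->
  walk Gamma x s (last x s) /\ walk Gamma (last x s) t z.
Proof.
rewrite /walk /is_walk cat_path last_cat.
by split=> [[/andP[? ?] ?]|[[-> _] [-> ->]]].
Qed.

(** The step at which the length of the initial part first reaches [T] is left
    out, so that both remaining parts are controlled. *)
Lemma floyd_length_split x s (T : R) : (0 < size s)%N -> 0 <= T <= len x s ->
  exists s1 b s2, [/\ s = s1 ++ b :: s2, len x s1 <= T & len b s2 <= len x s - T].
Proof.
elim: s x T => [//|a s IH] x T _ /andP[T0].
rewrite floyd_length_cons; set l := lam ^+ _ => TL.
have [Tl|lT] := leP T l.
  exists [::], a, s; split=> //; first by rewrite /floyd_length big_nil.
  lra.
have s0 : (0 < size s)%N.
  rewrite lt0n; apply/eqP => /size0nil s0.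
  by move: TL; rewrite s0 /floyd_length big_nil; lra.
have [|s1 [b [s2 [-> h1 h2]]]] := IH a (T - l) s0; first by apply/andP; lra.
by exists (a :: s1), b, s2; split=> //; rewrite ?floyd_length_cons -/l; lra.
Qed.

(** Induction on the number of steps.  Cut the path at half its length, as in
    [floyd_length_split]: both parts have less than half the bound, so the
    induction hypothesis puts their ends in [w (2n + 2)], and so is the middle
    edge by assumption.  Three members of [w (2n + 2)] in a row make one of
    [w (2n)]: the squares available at each level are used twice, which is why
    only every other term of the sequence appears. *)
Lemma chain_metrization (w : nat -> set (S2 M)) (c : R) :
    (forall n, @sdiag M `<=` w n) ->
    (forall n, spow (w n.+1) 2 `<=` w n) ->
    (forall n x y, edges Gamma (upair x y) ->
      lam ^+ edge_dist Gamma v x y < c / 2 ^+ n -> w n.*2 (upair x y)) ->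
  forall n x s y, walk Gamma x s y -> len x s < c / 2 ^+ n.+1 ->
    w n.*2 (upair x y).
Proof.
move=> wd wh we n x s; have [k] := ubnP (size s).
elim: k n x s => // k IH n x s lt_sk y W L.
have [/size0nil s0|s0] := posnP (size s).
  by move: W => [_]; rewrite s0 /= => <-; apply: wd; exists x.
have L0 := floyd_length_ge0 Gamma hlam v x s.
have [|s1 [b [s2 [E h1 h2]]]] := @floyd_length_split x s (len x s / 2) s0.
  by apply/andP; lra.
move: W lt_sk L; rewrite E => /walk_catP[W1 /walk_cons[e W2]] lt_sk.
rewrite size_cat /= in lt_sk.
rewrite -E => L.
have half : len x s / 2 < c / 2 ^+ n.+2.
  by rewrite [2 ^+ n.+2]exprSr invfM mulrA ltr_pM2r // invr_gt0.
have p1 : w n.*2.+2 (upair x (last x s1)).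
  rewrite -doubleS; apply: (IH n.+1 x s1) => //; [lia|lra].
have p3 : w n.*2.+2 (upair b y).
  rewrite -doubleS; apply: (IH n.+1 b s2) => //; [lia|lra].
have p2 : w n.*2.+2 (upair (last x s1) b).
  rewrite -doubleS; apply: we => //; apply: le_lt_trans L.
  rewrite E floyd_length_cat floyd_length_cons.
  have := floyd_length_ge0 Gamma hlam v x s1.
  have := floyd_length_ge0 Gamma hlam v b s2; lra.
have p3' : w n.*2.+1 (upair b y).
  by apply: (spow_small_chain (wh _) p3); apply: wd; exists y.
by apply: (spow_small_chain (wh _) _ p3'); exact: spow_small_chain (wh _) p1 p2.
Qed.

End floyd_comparison.

(** With [lam ^ (2 C) >= 1/2], an edge of length less than [lam ^ D / 2 ^ n] has
    length less than [lam ^ (2 C n + D)], hence is far enough from [v] to lie in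
    the entourage of index [2 n]. *)
Lemma divider_in_floyd (R : realType) (G : groupType) (M : gset G)
    (Gamma : connecting_graph M) (u : set (S2 M)) :
  divider u -> edge_cofinite Gamma u ->
  exists (lam : R) (hlam : 0 < lam < 1), floyd_uniformity Gamma hlam u.
Proof.
move=> [du [F finF hF]] cofu.
have [[v]|noM] := pselect (inhabited M); last first.
  have [lam hlam _] := slow_ratio R 0.
  exists lam, hlam; change (floyd_ents Gamma lam u) => v.
  by case: noM; split.
have [C [D hCD]] := far_edges_divider_iter v finF cofu.
have [lam hlam lamC] := slow_ratio R (C * 2)%N.
exists lam, hlam; change (floyd_ents Gamma lam u).
apply/(floyd_entsE Gamma hlam v).
have [lam0 lam1] := andP hlam.
have D0 : 0 < lam ^+ D / 2 by rewrite divr_gt0 // exprn_gt0.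
exists (lam ^+ D / 2) => // x y /(floyd_dist_lt hlam)[s W L].
apply: (chain_metrization hlam (v := v) (w := divider_iter u F)
  (c := lam ^+ D) _ _ _ (n := 0) W).
- by move=> n; exact: divider_iter_diag.
- by move=> n; exact: divider_iter_half.
- move=> n a b e lt_ab; apply: hCD => //.
  have : lam ^+ edge_dist Gamma v a b < lam ^+ (C * n.*2 + D).
    apply: (lt_le_trans lt_ab).
    rewrite addnC exprD ler_pM2l ?exprn_gt0 //.
    rewrite -muln2 mulnCA mulnC exprM -exprVn.
    by rewrite lerXn2r // nnegrE ?invr_ge0 // exprn_ge0 // ltW.
  by rewrite ltr_iXn2l.
- by rewrite expr1.
Qed.

Lemma floyd_contains_generated (R : realType) (G : groupType) (M : gset G)
    (Gamma : connecting_graph M) (U : uniformity M) u (lam : R)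
    (hlam : 0 < lam < 1) :
  generated_by U u -> floyd_uniformity Gamma hlam u ->
  ents U `<=` ents (floyd_uniformity Gamma hlam).
Proof.
move=> -> Vu; apply: smallest_sub; first exact: ents_filter.
by move=> _ [g _ <-]; exact: floyd_invariant.
Qed.

(** * Geodesics from the base point *)

Section geodesics.
Context (R : realType) (G : groupType) (M : gset G).
Context (Gamma : connecting_graph M) (lam : R) (hlam : 0 < lam < 1) (v : M).

(** The walk [b :: s] is the end of a geodesic from [v] to [x]. *)
Definition radial (b : M) (s : seq M) (x : M) : Prop :=
  walk Gamma b s x /\ (gdist Gamma v b + size s)%N = gdist Gamma v x.

Lemma gdist_edge a b : edges Gamma (upair a b) -> (gdist Gamma a b <= 1)%N.
Proof.
by move=> e; apply: (@gdist_le _ _ _ _ _ [:: b]); apply/walk_cons.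
Qed.

Lemma radial_cons b a s x : radial b (a :: s) x ->
  [/\ edges Gamma (upair b a), gdist Gamma v a = (gdist Gamma v b).+1 &
      radial a s x].
Proof.
move=> [/walk_cons[e W] /= E].
have h1 := gdist_triangle Gamma v b a; have h2 := gdist_edge e.
have h3 := gdist_triangle Gamma v a x; have h4 := gdist_le W.
by split=> //; [|split=> //]; lia.
Qed.

(** Successive edges of a radial walk are at distances [d], [d + 1], and so on,
    from [v], where [d] is the distance of [b]; their lengths are dominated by a
    geometric series. *)
Lemma floyd_dist_radial b s x : radial b s x ->
  floyd_dist Gamma v lam b x <= lam ^+ gdist Gamma v b / (1 - lam).
Proof.
have [lam0 lam1] := andP hlam.
move=> rad; apply: le_trans (floyd_dist_le hlam v rad.1) _.
elim: s b rad => [|a s IH] b.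
  rewrite /floyd_length big_nil => _; rewrite divr_ge0 ?exprn_ge0 //; lra.
move=> /radial_cons[_ Ea /IH]; rewrite floyd_length_cons /edge_dist Ea.
rewrite (minn_idPl _) // exprS => h.
have -> : lam ^+ gdist Gamma v b / (1 - lam) =
    lam ^+ gdist Gamma v b + lam * lam ^+ gdist Gamma v b / (1 - lam).
  by field; lra.
by rewrite lerD2l.
Qed.

(** The walk is turned into an infinite sequence, constant once [x] is reached,
    so that geodesics to all points can be compared level by level. *)
Lemma radial_trajectory b s x : radial b s x -> exists c : nat -> M,
  [/\ c 0%N = b,
      forall j, floyd_dist Gamma v lam (c j) x <=
        lam ^+ (gdist Gamma v b + j) / (1 - lam) &
      forall j, c j = c j.+1 \/ edges Gamma (upair (c j) (c j.+1))].
Proof.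
have [lam0 lam1] := andP hlam.
elim: s b => [|a s IH] b rad.
  exists (fun=> b); split=> // j; last by left.
  have -> : b = x by case: rad => -[].
  apply: (@le_trans _ _ 0); first exact: (floyd_distxx Gamma hlam v x).
  by rewrite divr_ge0 ?exprn_ge0 //; lra.
have [e Ea rad'] := radial_cons rad.
have [c [c0 cd ce]] := IH a rad'.
exists (fun i => if i is i'.+1 then c i' else b); split=> //.
  move=> [|j]; first by rewrite addn0; exact: floyd_dist_radial rad.
  by rewrite addnS -addSn -Ea.
by move=> [|j]; [right; rewrite c0|exact: ce].
Qed.

Lemma geodesic x : exists c : nat -> M,
  [/\ c 0%N = v,
      forall j, floyd_dist Gamma v lam (c j) x <= lam ^+ j / (1 - lam) &
      forall j, c j = c j.+1 \/ edges Gamma (upair (c j) (c j.+1))].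
Proof.
have [s W sz] := gdistP Gamma v x.
have v0 : gdist Gamma v v = 0%N.
  by apply/eqP; rewrite -leqn0; apply: (@gdist_le _ _ _ _ _ [::]).
have rad : radial v s x by split=> //; rewrite v0.
have [c [c0 cd ce]] := radial_trajectory rad.
by exists c; split=> // j; have := cd j; rewrite v0.
Qed.

End geodesics.

(** * Surjectivity *)

Section surjectivity.
Context (R : realType) (G : groupType) (M : gset G).
Context (Gamma : connecting_graph M) (lam : R) (hlam : 0 < lam < 1).
Context (U : uniformity M).
Local Notation V := (floyd_uniformity Gamma hlam).
Context (UV : ents U `<=` ents V).
Context (Ucof : forall w, U w -> edge_cofinite Gamma w).

(** The alternative is whether the set of levels [j] at which the geodesics to
    [W]-almost all [x] go through the same vertex is unbounded.  If it is, the
    set of such [x] is [W]-large and Floyd-small.  If it has a last level [K],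
    the geodesics fan out after the vertex [a] at level [K]. *)
Lemma ultrafilter_dichotomy (W : set_system M) : UltraFilter W ->
  cauchy_filter V W \/ exists a, unif_nbhs U a `<=` W.
Proof.
move=> UW; have PW : ProperFilter W := @ultra_proper _ _ UW.
have [v _] := filter_ex (@filterT _ W _).
have /choice[c cP] := geodesic Gamma hlam v.
pose P j := exists a, W [set x | c x j = a].
have P0 : P 0%N by exists v; apply: filterS (@filterT _ W _) => x _; case: (cP x).
have [inf|[K [a Wa] lastK]] := last_index P0.
  left; split; first exact: PW.
  move=> u Vu; have [e e0 hu] := (floyd_entsE Gamma hlam v u).1 Vu.
  have e20 : 0 < e / 2 by rewrite divr_gt0.
  have [J hJ] := geometric_small hlam e20.
  have [j le_Jj [a Wa]] := inf J; exists [set x | c x j = a] => // x y xa ya.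
  have near z : c z j = a -> floyd_dist Gamma v lam a z < e / 2.
    by move=> <-; case: (cP z) => _ /(_ j) + _ => /le_lt_trans; apply; exact: hJ.
  apply: hu; rewrite [e]splitr.
  apply: (floyd_dist_triangle hlam (floyd_dist_sym hlam (near _ xa))).
  exact: near.
right; exists a => A [u Uu uA].
(* One half of [u] is for the tail after level [K + J], short in the Floyd
   metric; the other one for the [J] steps between the levels [K] and [K + J]. *)
have [u' Uu' u'u] := ents_half Uu.
have [e e0 hu'] := (floyd_entsE Gamma hlam v u').1 (UV Uu').
have [J hJ] := geometric_small hlam e0.
have [w Uw wu'] := entourage_chain J Uu'.
(* Almost every geodesic avoids, at the levels from [K + 1] to [K + J], both
   ends of the finitely many edges outside [w]: a nonprincipal ultrafilter
   avoids every point. *)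
have WJ : W (\bigcap_(i in `I_J) \bigcap_(p in [set p | edges Gamma p /\ ~ w p])
    [set x | ~ sval p (c x (K + i.+1)%N)]).
  apply: filter_finite_bigI; first exact: finite_II.
  move=> i _; apply: filter_finite_bigI; first exact: Ucof.
  move=> p _; case: (S2P p) => b [b' ->].
  have avoid d : W [set x | c x (K + i.+1)%N <> d].
    have [Wd|//] := in_ultra_setVsetC [set x | c x (K + i.+1)%N = d] UW.
    by case: (lastK (K + i.+1)%N); [lia|exists d].
  apply: filterS (filterI (avoid b) (avoid b')) => x [nb nb'] /=.
  by case.
apply: filterS (filterI Wa WJ) => x [xa xJ]; apply: uA => /=.
have [_ cd ce] := cP x.
apply: (spow_small_chain u'u (y := c x (K + J)%N)); last first.
  apply: hu'; apply: le_lt_trans (cd _) (hJ _ _); lia.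
have <- : c x (K + 0)%N = a by rewrite addn0.
apply: (wu' (fun i => c x (K + i)%N)) => i lt_iJ; rewrite addnS.
have [->|e_i] := ce (K + i)%N; first exact: unif_refl Uw.
apply: contrapT => nw; apply: (xJ i lt_iJ _ (conj e_i nw)).
by rewrite addnS; right.
Qed.

Lemma completion_map_surjective (xi : completion U) :
  exists zeta, completion_map UV zeta = xi.
Proof.
have [Pxi _] := (svalP xi).1.
have [W [UW xiW]] := ultraFilterLemma Pxi.
have PW : ProperFilter W := @ultra_proper _ _ UW.
have [CW|[a aW]] := ultrafilter_dichotomy UW.
  exists (exist _ _ (cauchy_core_minimal CW)).
  by apply: (@completion_map_eq _ _ _ _ _ _ W) => //; exact: cauchy_core_sub.
exists (to_completion V a); rewrite completion_map_point; apply: completion_inj.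
rewrite (minimal_cauchy_core PW (svalP xi) xiW) /=.
exact: (minimal_cauchy_core PW (unif_nbhs_minimal U a) aW).
Qed.

End surjectivity.

(** * The theorem *)

Theorem proposition3p4p6 (R : realType) (G : groupType) (M : gset G)
  (HM : connected_gset M) (Gamma : connecting_graph M) (U : uniformity M)
  (HU : relatively_hyperbolic U) :
  exists (lam : R) (hlam : 0 < lam < 1),
    ents U `<=` ents (floyd_uniformity Gamma hlam) /\
    exists phi : completion_gset (floyd_invariant Gamma hlam) ->
                 completion_gset (relatively_hyperbolic_invariant HU),
      [/\ forall x : M, phi (to_completion (floyd_uniformity Gamma hlam) x) = to_completion U x,
          unif_continuous (completion_uniformity (floyd_uniformity Gamma hlam))
            (completion_uniformity U) phi,
          equivariant phi
        & forall xi, exists zeta, phi zeta = xi].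
Proof.
have [[u [du pu gu]] _] := HU.
have cof w : U w -> edge_cofinite Gamma w by exact: entourage_edge_cofinite pu gu.
have Uu : U u.
  rewrite gu; apply: sub_gen_smallest; exists 1%g => //.
  apply/seteqP; split=> p; first by case=> q uq <-; rewrite sact1.
  by move=> up; exists p => //; rewrite sact1.
have [lam [hlam Vu]] := divider_in_floyd R du (cof u Uu).
have UV := floyd_contains_generated gu Vu.
exists lam, hlam; split=> //; exists (completion_map UV); split.
- exact: completion_map_point.
- exact: completion_map_unif_continuous.
- exact: completion_map_equivariant.
- exact: completion_map_surjective.
Qed.
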